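(* Let $\alpha\in(0,1)$, let $p\ge3$ be an odd integer, and $n(x)=x^p$. Let $s\mapsto(\varphi(s),c(s))$ be the local analytic curve of even, zero-mean, $2\pi$-periodic solutions of the steady equation bifurcating from $(0,1)$, parametrised so that $s\mapsto c(s)$ is even (with first cosine coefficient of $\varphi(s)$ equal to $s$). Then the analytic expansions of $\varphi(s)$ and $c(s)$ have the form $$\varphi(s)=\sum_{j=0}^\infty\varphi_{j(p-1)+1}\,s^{j(p-1)+1}\qquad\text{and}\qquad c(s)=\sum_{j=0}^\infty\varsigma_{j(p-1)}\,s^{j(p-1)}$$ on this local curve, where all the functions $\varphi_{j(p-1)+1}$ lie in $\mathcal{W}:=\operatorname{span}\{\cos(k\,\cdot):k\ge1\text{ odd}\}$. Hence each $\varphi_{j(p-1)+1}$, and thus also $\varphi(s)$, is antisymmetric about $-\frac\pi2$ (i.e. $\psi(\cdot+\pi)=-\psi$).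
   Context: $\mathbb{T}=\mathbb{R}/2\pi\mathbb{Z}$. For zero-mean $\varphi$ on $\mathbb{T}$, $|\mathrm{D}|^{-\alpha}\varphi$ is the zero-mean function with Fourier coefficients $|k|^{-\alpha}\widehat\varphi(k)$, $k\neq0$. The steady equation is $$F(\varphi,c):=|\mathrm{D}|^{-\alpha}\varphi-c\varphi+n(\varphi)-\frac1{2\pi}\int_{\mathbb{T}}n(\varphi(y))\,dy=0 .$$ Fix $\beta\in(\max\{\alpha,\frac12\},1)$ and let $\mathcal{X}^\beta$ be the space of even, zero-mean, $\beta$-Hölder continuous functions on $\mathbb{T}$. By the analytic Crandall–Rabinowitz theorem there is a local analytic curve $s\mapsto(\varphi(s),c(s))\in\mathcal{X}^\beta\times[0,\infty)$ around $s=0$ of solutions of $F=0$, nontrivial for $s\neq0$, with $(\varphi(0),c(0))=(0,1)$, and near $(0,1)$ these are all the nontrivial solutions in $\mathcal{X}^\beta\times[0,\infty)$. It is parametrised by $\frac1\pi\int_{\mathbb{T}}\varphi(s)(x)\cos x\,dx=s$, for which $c$ is even in $s$. A priori $\varphi(s)=\sum_{\ell\ge1}\varphi_\ell s^\ell$ and $c(s)=\sum_{\ell\ge0}\varsigma_{2\ell}s^{2\ell}$ with $\varphi_\ell\in\mathcal{X}^\beta$, $\varsigma_{2\ell}\in\mathbb{R}$. *)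

(* Defs.v *)
(* Functions on the torus R/2piZ are 2pi-periodic functions R -> R. *)
From Stdlib Require Import Reals ZArith Arith.
From Coquelicot Require Import Coquelicot.
Open Scope R_scope.

Definition periodic (f : R -> R) : Prop := forall x, f (x + 2 * PI) = f x.

Definition even_fun (f : R -> R) : Prop := forall x, f (- x) = f x.

Definition mean (f : R -> R) : R := / (2 * PI) * RInt f 0 (2 * PI).

(* (1/2pi) int f(x) e^{-ikx} dx, as a pair (real part, imaginary part) *)
Definition fourier (f : R -> R) (k : Z) : C :=
  (mean (fun x => f x * cos (IZR k * x)),
   - mean (fun x => f x * sin (IZR k * x))).

(* psi = |D|^{-alpha} phi. Continuity makes psi unique as a pointwise
   function, since continuous functions are determined by their Fourier
   coefficients. *)
Definition is_absD_neg (alpha : R) (phi psi : R -> R) : Prop :=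
  periodic psi /\ (forall x, continuous psi x) /\ mean psi = 0 /\
  forall k : Z, k <> 0%Z ->
    fourier psi k = Cmult (RtoC (Rpower (Rabs (IZR k)) (- alpha))) (fourier phi k).

(* F(phi, c) = 0 *)
Definition steady (alpha : R) (n : R -> R) (phi : R -> R) (c : R) : Prop :=
  exists psi, is_absD_neg alpha phi psi /\
    forall x, psi x - c * phi x + n (phi x) - mean (fun y => n (phi y)) = 0.

(* sup |f| + sup_{x <> y} |f x - f y| / |x - y|^beta. For periodic f the
   seminorm is the same with the distance of the torus. *)
Definition holder_norm (beta : R) (f : R -> R) : Rbar :=
  Rbar_plus
    (Lub_Rbar (fun q => exists x, q = Rabs (f x)))
    (Lub_Rbar (fun q => exists x y, x <> y /\
       q = Rabs (f x - f y) / Rpower (Rabs (x - y)) beta)).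

Definition Xspace (beta : R) (f : R -> R) : Prop :=
  periodic f /\ even_fun f /\ Rbar_lt (holder_norm beta f) p_infty /\ mean f = 0.

(* sum_l u_l = f with convergence of the partial sums in the Hoelder norm *)
Definition is_holder_series (beta : R) (u : nat -> R -> R) (f : R -> R) : Prop :=
  forall eps : R, 0 < eps ->
    eventually (fun N =>
      Rbar_lt (holder_norm beta (fun x => f x - sum_n (fun l => u l x) N)) eps).

(* s |-> (phi s, c s), |s| < r, is the local curve of nontrivial solutions
   bifurcating from (0, 1), with expansions sum_l phic_l s^l and
   sum_l varsigma_l s^l at s = 0. *)
Record bifurcation_curve (alpha beta : R) (n : R -> R) (r : R)
    (phi : R -> R -> R) (c : R -> R)
    (phic : nat -> R -> R) (varsigma : nat -> R) : Prop := {
  curve_radius : 0 < r;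
  curve_phi0 : forall x, phi 0 x = 0;
  curve_c0 : c 0 = 1;
  curve_space : forall s, Rabs s < r -> Xspace beta (phi s) /\ 0 <= c s;
  curve_steady : forall s, Rabs s < r -> steady alpha n (phi s) (c s);
  curve_nontrivial : forall s, Rabs s < r -> s <> 0 -> exists x, phi s x <> 0;
  curve_param : forall s, Rabs s < r ->
    / PI * RInt (fun x => phi s x * cos x) 0 (2 * PI) = s;
  curve_c_even : forall s, Rabs s < r -> c (- s) = c s;
  curve_phic_space : forall l, Xspace beta (phic l);
  curve_phi_expansion : forall s, Rabs s < r ->
    is_holder_series beta (fun l x => phic l x * s ^ l) (phi s);
  curve_c_expansion : forall s, Rabs s < r ->
    is_series (fun l => varsigma l * s ^ l) (c s);
  curve_unique : exists eps : R, 0 < eps /\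
    forall (f : R -> R) (d : R),
      Xspace beta f -> 0 <= d -> steady alpha n f d -> (exists x, f x <> 0) ->
      Rbar_lt (holder_norm beta f) eps -> Rabs (d - 1) < eps ->
      exists s, Rabs s < r /\ s <> 0 /\ (forall x, f x = phi s x) /\ d = c s
}.

(* algebraic (finite) span of the functions cos(k x), k >= 1 odd *)
Definition Wspan (f : R -> R) : Prop :=
  exists (N : nat) (a : nat -> R),
    forall x, f x = sum_n (fun j => a j * cos (INR (2 * j + 1) * x)) N.

Definition antisymmetric_about (a : R) (f : R -> R) : Prop :=
  forall x, f (a + x) = - f (a - x).

Definition antiperiodic_PI (f : R -> R) : Prop := forall x, f (x + PI) = - f x.

(* Main.v *)
Require Import Defs.
From Stdlib Require Import Reals ZArith Arith Bool Lra Lia Classical FunctionalExtensionality.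
From Coquelicot Require Import Coquelicot.
Open Scope R_scope.

(* Taking the k-th cosine coefficient of the steady equation and equating powers of s gives,
   with A_m(k) the coefficient of phi_m and B_m(k) that of the s^m term of phi^p,
     k^(-alpha) A_m(k) - sum_j varsigma_j A_(m-j)(k) + B_m(k) = 0   for k >= 1.
   As p >= 2, B_m only involves phi_i with i < m. For k = 1 the parametrisation
   A_m(1) = delta_(m1) / 2 turns this into a formula for varsigma_(m-1), and for k >= 2
   it determines A_m(k) because k^(-alpha) <> 1. Products of p odd cosine polynomials are
   again such, and indices congruent to 1 mod p - 1 add up to p = 1 mod p - 1 under p-th
   powers, so strong induction on m yields both the gaps in the expansions and
   phi_m in W, the cosine system being complete among continuous even functions.
   Antisymmetry of phi(s) is then inherited termwise. *)

(** * Means and cosine coefficients *)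

Definition cont (f : R -> R) : Prop := forall x, continuous f x.

Lemma cont_const (a : R) : cont (fun _ => a).
Proof. intros x; apply continuous_const. Qed.

Lemma cont_cos (a : R) : cont (fun x => cos (a * x)).
Proof.
intros x; apply (continuous_comp (fun y => a * y) cos).
- apply (continuous_mult (fun _ => a) (fun y => y));
    [apply continuous_const | apply continuous_id].
- apply continuous_cos.
Qed.

Lemma cont_plus (f g : R -> R) : cont f -> cont g -> cont (fun x => f x + g x).
Proof. intros Hf Hg x; exact (continuous_plus f g x (Hf x) (Hg x)). Qed.

Lemma cont_mult (f g : R -> R) : cont f -> cont g -> cont (fun x => f x * g x).
Proof. intros Hf Hg x; exact (continuous_mult f g x (Hf x) (Hg x)). Qed.

Lemma cont_scal (a : R) (f : R -> R) : cont f -> cont (fun x => a * f x).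
Proof. intros Hf; exact (cont_mult _ _ (cont_const a) Hf). Qed.

Lemma cont_minus (f g : R -> R) : cont f -> cont g -> cont (fun x => f x - g x).
Proof. intros Hf Hg x; exact (continuous_minus f g x (Hf x) (Hg x)). Qed.

Lemma cont_pow (f : R -> R) (n : nat) : cont f -> cont (fun x => f x ^ n).
Proof.
intros Hf; induction n as [|n IH]; simpl.
- exact (cont_const 1).
- exact (cont_mult _ _ Hf IH).
Qed.

Lemma cont_sum_n (u : nat -> R -> R) (N : nat) :
  (forall l, cont (u l)) -> cont (fun x => sum_n (fun l => u l x) N).
Proof.
intros Hu; induction N as [|N IH].
- intros x; apply continuous_ext with (u 0%nat); [|apply Hu].
  now intros y; rewrite sum_O.
- intros x.
  apply continuous_ext with (fun y => sum_n (fun l => u l y) N + u (S N) y).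
  + now intros y; rewrite sum_Sn.
  + exact (cont_plus _ _ IH (Hu (S N)) x).
Qed.

Lemma cont_ex_RInt (f : R -> R) (a b : R) : cont f -> ex_RInt f a b.
Proof. intros Hf; apply (ex_RInt_continuous (V := R_CompleteNormedModule)); auto. Qed.

Lemma mean_ext (f g : R -> R) : (forall x, f x = g x) -> mean f = mean g.
Proof. now intros H; unfold mean; f_equal; apply RInt_ext; intros; apply H. Qed.

Lemma mean_plus (f g : R -> R) :
  cont f -> cont g -> mean (fun x => f x + g x) = mean f + mean g.
Proof.
intros Hf Hg; unfold mean.
rewrite (RInt_plus f g) by now apply cont_ex_RInt.
unfold plus; simpl; ring.
Qed.

Lemma mean_scal (a : R) (f : R -> R) : cont f -> mean (fun x => a * f x) = a * mean f.
Proof.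
intros Hf; unfold mean.
rewrite (RInt_scal f) by now apply cont_ex_RInt.
unfold scal; simpl; unfold mult; simpl; ring.
Qed.

Lemma mean_minus (f g : R -> R) :
  cont f -> cont g -> mean (fun x => f x - g x) = mean f - mean g.
Proof.
intros Hf Hg.
rewrite (mean_ext _ (fun x => f x + (-1) * g x)) by (intros; ring).
rewrite mean_plus, mean_scal; auto using cont_scal; ring.
Qed.

Lemma mean_const (a : R) : mean (fun _ => a) = a.
Proof.
unfold mean; rewrite RInt_const; unfold scal; simpl; unfold mult; simpl.
field; apply PI_neq0.
Qed.

Lemma mean_bound (f : R -> R) (M : R) :
  cont f -> (forall x, Rabs (f x) <= M) -> Rabs (mean f) <= M.
Proof.
intros Hf HM; unfold mean; pose proof PI_RGT_0 as Hpi.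
rewrite Rabs_mult, (Rabs_pos_eq (/ (2 * PI)))
  by (apply Rlt_le, Rinv_0_lt_compat; lra).
apply Rle_trans with (/ (2 * PI) * ((2 * PI - 0) * M)).
- apply Rmult_le_compat_l; [apply Rlt_le, Rinv_0_lt_compat; lra|].
  apply abs_RInt_le_const; auto using cont_ex_RInt; lra.
- right; field; lra.
Qed.

(** Normalised by the mean, so for [k >= 1] it is half the usual cosine coefficient; hence the [/ 2]
    in the normalisation of the curve. It is the real part of [fourier f k]. *)
Definition cosc (f : R -> R) (k : nat) : R := mean (fun x => f x * cos (INR k * x)).

Lemma cosc_ext (f g : R -> R) (k : nat) : (forall x, f x = g x) -> cosc f k = cosc g k.
Proof. now intros H; apply mean_ext; intros; rewrite H. Qed.

Lemma cosc_plus (f g : R -> R) (k : nat) :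
  cont f -> cont g -> cosc (fun x => f x + g x) k = cosc f k + cosc g k.
Proof.
intros Hf Hg; unfold cosc.
rewrite <- mean_plus by (apply cont_mult; auto using cont_cos).
apply mean_ext; intros; ring.
Qed.

Lemma cosc_scal (a : R) (f : R -> R) (k : nat) :
  cont f -> cosc (fun x => a * f x) k = a * cosc f k.
Proof.
intros Hf; unfold cosc.
rewrite <- mean_scal by (apply cont_mult; auto using cont_cos).
apply mean_ext; intros; ring.
Qed.

Lemma cosc_minus (f g : R -> R) (k : nat) :
  cont f -> cont g -> cosc (fun x => f x - g x) k = cosc f k - cosc g k.
Proof.
intros Hf Hg; unfold cosc.
rewrite <- mean_minus by (apply cont_mult; auto using cont_cos).
apply mean_ext; intros; ring.
Qed.

Lemma cosc_bound (f : R -> R) (k : nat) (M : R) :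
  cont f -> (forall x, Rabs (f x) <= M) -> Rabs (cosc f k) <= M.
Proof.
intros Hf HM; apply mean_bound; [now apply cont_mult; auto using cont_cos|].
intros x; rewrite Rabs_mult.
rewrite <- (Rmult_1_r M); apply Rmult_le_compat; auto using Rabs_pos.
apply Rabs_le, COS_bound.
Qed.

Lemma cosc_zero (f : R -> R) (k : nat) : (forall x, f x = 0) -> cosc f k = 0.
Proof.
intros H; unfold cosc; rewrite (mean_ext _ (fun _ => 0)).
- apply mean_const.
- intros; rewrite H; ring.
Qed.

Lemma cosc_sum_n (u : nat -> R -> R) (k N : nat) :
  (forall l, cont (u l)) ->
  cosc (fun x => sum_n (fun l => u l x) N) k = sum_n (fun l => cosc (u l) k) N.
Proof.
intros Hu; induction N as [|N IH].
- rewrite sum_O; apply cosc_ext; intros; now rewrite sum_O.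
- rewrite sum_Sn, <- IH.
  rewrite (cosc_ext _ (fun x => sum_n (fun l => u l x) N + u (S N) x))
    by (intros; now rewrite sum_Sn).
  now apply cosc_plus; auto using cont_sum_n.
Qed.

(** The antiderivative [sin (z x) / z] takes the same value at both ends of the period. Integer
    frequencies cover sums and differences of natural ones at once. *)
Lemma mean_cos_IZR (z : Z) : z <> 0%Z -> mean (fun x => cos (IZR z * x)) = 0.
Proof.
intros Hz; pose proof (not_0_IZR z Hz) as Hz'.
unfold mean; apply Rmult_eq_0_compat_l, is_RInt_unique.
replace 0 with (minus (/ IZR z * sin (IZR z * (2 * PI))) (/ IZR z * sin (IZR z * 0))) at 2.
- apply (is_RInt_derive (fun x => / IZR z * sin (IZR z * x))).
  + intros x _; auto_derive; [easy | field; easy].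
  + intros x _; apply cont_cos.
- rewrite Rmult_0_r, sin_0.
  replace (IZR z * (2 * PI)) with (0 + 2 * IZR z * PI) by ring.
  assert (E : sin (0 + 2 * IZR z * PI) = 0).
  { apply sin_eq_0_1; exists (2 * z)%Z; rewrite mult_IZR; ring. }
  rewrite E; unfold minus, plus, opp; simpl; ring.
Qed.

Lemma cos_mult_cos (a b : R) : cos a * cos b = / 2 * (cos (a + b) + cos (a - b)).
Proof. rewrite cos_plus, cos_minus; field. Qed.

Lemma cosc_cos_neq (j k : nat) : j <> k -> cosc (fun x => cos (INR j * x)) k = 0.
Proof.
intros Hjk; unfold cosc.
rewrite (mean_ext _ (fun x => / 2 * (cos (IZR (Z.of_nat j + Z.of_nat k) * x)
   + cos (IZR (Z.of_nat j - Z.of_nat k) * x)))).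
- rewrite mean_scal, mean_plus by auto using cont_plus, cont_cos.
  rewrite 2!mean_cos_IZR by lia; ring.
- intros x; rewrite cos_mult_cos, plus_IZR, minus_IZR, <- 2!INR_IZR_INZ.
  do 3 f_equal; ring.
Qed.

Lemma cosc_cos_1 : cosc (fun x => cos (INR 1 * x)) 1 = / 2.
Proof.
unfold cosc.
rewrite (mean_ext _ (fun x => / 2 * (cos (IZR 2 * x) + 1))).
- rewrite mean_scal, mean_plus, mean_cos_IZR, mean_const
    by first [lia | auto using cont_plus, cont_cos, cont_const].
  ring.
- intros x; rewrite cos_mult_cos; simpl.
  replace (1 * x - 1 * x) with 0 by ring; rewrite cos_0.
  do 3 f_equal; ring.
Qed.

Lemma cosc_const (a : R) (k : nat) : (1 <= k)%nat -> cosc (fun _ => a) k = 0.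
Proof.
intros Hk; unfold cosc; rewrite mean_scal by apply cont_cos.
rewrite (mean_ext _ (fun x => cos (IZR (Z.of_nat k) * x)))
  by (intros; now rewrite INR_IZR_INZ).
rewrite mean_cos_IZR by lia; ring.
Qed.

(** * Trigonometric polynomials in cosines of fixed parity *)

(** Finite cosine sums, repetitions allowed, whose frequencies all have parity [b]: [true] gives the
    space W, [false] includes the constants through frequency 0. The constructors use pointwise
    equality, so no extensionality of functions is involved. *)
Inductive trig (b : bool) : (R -> R) -> Prop :=
| trig_zero (f : R -> R) : (forall x, f x = 0) -> trig b f
| trig_add (a : R) (k : nat) (f g : R -> R) :
    Nat.odd k = b -> trig b f ->
    (forall x, g x = a * cos (INR k * x) + f x) -> trig b g.

Lemma trig_ext (b : bool) (f g : R -> R) : (forall x, g x = f x) -> trig b f -> trig b g.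
Proof.
intros E H; destruct H as [f H | a k f h Hk Hf H].
- apply trig_zero; intros; now rewrite E.
- apply (trig_add b a k f); auto; intros; now rewrite E.
Qed.

Lemma trig_cont (b : bool) (f : R -> R) : trig b f -> cont f.
Proof.
intros H; induction H as [f H | a k f g Hk Hf IH H]; intros x.
- apply continuous_ext with (fun _ => 0); [intros; now rewrite H | apply continuous_const].
- apply continuous_ext with (fun x => a * cos (INR k * x) + f x); [intros; now rewrite H|].
  apply cont_plus; auto using cont_scal, cont_cos.
Qed.

Lemma trig_cos (k : nat) : trig (Nat.odd k) (fun x => cos (INR k * x)).
Proof.
apply (trig_add _ 1 k (fun _ => 0)); auto; [now apply trig_zero | intros; ring].
Qed.

Lemma trig_plus (b : bool) (f g : R -> R) :
  trig b f -> trig b g -> trig b (fun x => f x + g x).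
Proof.
intros Hf Hg; induction Hf as [f H | a k f h Hk Hf IH H].
- apply (trig_ext b g); auto; intros; rewrite H; ring.
- apply (trig_add b a k (fun x => f x + g x)); auto; intros; rewrite H; ring.
Qed.

Lemma trig_scal (b : bool) (a : R) (f : R -> R) : trig b f -> trig b (fun x => a * f x).
Proof.
intros Hf; induction Hf as [f H | a' k f h Hk Hf IH H].
- apply trig_zero; intros; rewrite H; ring.
- apply (trig_add b (a * a') k (fun x => a * f x)); auto; intros; rewrite H; ring.
Qed.

Lemma trig_sum_f_R0 (b : bool) (u : nat -> R -> R) (N : nat) :
  (forall l, (l <= N)%nat -> trig b (u l)) ->
  trig b (fun x => sum_f_R0 (fun l => u l x) N).
Proof.
intros H; induction N as [|N IH]; simpl.
- now apply H.
- apply trig_plus; auto.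
Qed.

(** By the product-to-sum formula, [cos (k x) cos (j x)] has the frequencies [k + j] and [|k - j|],
    which have the same parity. *)
Lemma trig_mult_cos (b : bool) (k : nat) (f : R -> R) :
  trig b f -> trig (xorb (Nat.odd k) b) (fun x => cos (INR k * x) * f x).
Proof.
intros Hf; induction Hf as [f H | a j f h Hj Hf IH H].
- apply trig_zero; intros; rewrite H; ring.
- assert (Hd : exists d, Nat.odd d = xorb (Nat.odd k) b /\
    forall x, cos (INR k * x - INR j * x) = cos (INR d * x)).
  { destruct (le_ge_dec j k) as [L|L].
    - exists (k - j)%nat; split.
      + now rewrite Nat.odd_sub, Hj.
      + intros x; rewrite minus_INR by auto; f_equal; ring.
    - exists (j - k)%nat; split.
      + now rewrite Nat.odd_sub, Hj, Bool.xorb_comm.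
      + intros x; rewrite minus_INR by auto.
        rewrite <- cos_neg; f_equal; ring. }
  destruct Hd as (d & Hd & Ed).
  apply (trig_add _ (a / 2) (k + j) (fun x => a / 2 * cos (INR d * x) + cos (INR k * x) * f x)).
  + now rewrite Nat.odd_add, Hj.
  + now apply (trig_add _ (a / 2) d (fun x => cos (INR k * x) * f x)).
  + intros x; rewrite H.
    replace (cos (INR k * x) * (a * cos (INR j * x) + f x))
      with (a * (cos (INR k * x) * cos (INR j * x)) + cos (INR k * x) * f x) by ring.
    rewrite cos_mult_cos, Ed, plus_INR, Rmult_plus_distr_r; field.
Qed.

Lemma trig_mult (b c : bool) (f g : R -> R) :
  trig b f -> trig c g -> trig (xorb b c) (fun x => f x * g x).
Proof.
intros Hf Hg; induction Hf as [f H | a k f h Hk Hf IH H].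
- apply trig_zero; intros; rewrite H; ring.
- apply (trig_ext _ (fun x => a * (cos (INR k * x) * g x) + f x * g x)).
  + intros x; rewrite H; ring.
  + apply trig_plus; auto; apply trig_scal.
    rewrite <- Hk; now apply trig_mult_cos.
Qed.

(** A Fourier multiplier acts on a cosine sum frequency by frequency. This is what inverts the
    linearised operator without leaving the trigonometric polynomials. *)
Lemma trig_multiplier (b : bool) (lam : nat -> R) (f : R -> R) :
  trig b f -> exists g, trig b g /\ forall k, cosc g k = lam k * cosc f k.
Proof.
intros Hf; induction Hf as [f H | a j f h Hj Hf (g & Hg & IH) H].
- exists (fun _ => 0); split; [now apply trig_zero|].
  intros k; rewrite 2!cosc_zero; auto; ring.
- exists (fun x => (a * lam j) * cos (INR j * x) + g x); split.
  + now apply (trig_add b (a * lam j) j g).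
  + intros k; pose proof (trig_cont _ _ Hf); pose proof (trig_cont _ _ Hg).
    rewrite (cosc_ext h _ k H).
    rewrite 2!cosc_plus, 2!cosc_scal, IH by auto using cont_scal, cont_cos.
    destruct (Nat.eq_dec j k) as [->|N]; [ring|].
    rewrite cosc_cos_neq by auto; ring.
Qed.

Lemma trig_periodic_even (b : bool) (f : R -> R) : trig b f -> periodic f /\ even_fun f.
Proof.
intros Hf; induction Hf as [f H | a k f g Hk Hf [IHp IHe] H]; split; intros x.
- now rewrite 2!H.
- now rewrite 2!H.
- rewrite 2!H, IHp; do 2 f_equal.
  rewrite Rmult_plus_distr_l, <- (cos_period (INR k * x) k); f_equal; ring.
- rewrite 2!H, IHe; do 2 f_equal.
  rewrite <- cos_neg; f_equal; ring.
Qed.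

Lemma trig_odd_antiperiodic (f : R -> R) : trig true f -> antiperiodic_PI f.
Proof.
intros Hf; induction Hf as [f H | a k f g Hk Hf IH H]; intros x.
- rewrite 2!H; ring.
- rewrite 2!H, IH.
  apply Nat.odd_spec in Hk; destruct Hk as [m ->].
  replace (INR (2 * m + 1) * (x + PI))
    with (INR (2 * m + 1) * x + PI + 2 * INR m * PI)
    by (rewrite plus_INR, mult_INR; simpl; ring).
  rewrite cos_period, neg_cos; ring.
Qed.

(** [trig] allows frequencies in any order, [Wspan] wants one coefficient per odd frequency: the
    list is padded with zeros and the new term is added at position [m]. *)
Lemma trig_odd_Wspan (f : R -> R) : trig true f -> Wspan f.
Proof.
intros Hf; induction Hf as [f H | a k f g Hk Hf (N & u & IH) H].
- exists 0%nat, (fun _ => 0); intros x; rewrite H, sum_O; ring.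
- apply Nat.odd_spec in Hk; destruct Hk as [m ->].
  assert (Hpad : forall d x, sum_n (fun j => (if (j <=? N)%nat then u j else 0)
      * cos (INR (2 * j + 1) * x)) (N + d) = f x).
  { intros d x; induction d as [|d IHd].
    - rewrite Nat.add_0_r, IH; apply sum_n_ext_loc; intros j Hj.
      now rewrite (proj2 (Nat.leb_le j N) Hj).
    - rewrite Nat.add_succ_r, sum_Sn, IHd.
      rewrite (proj2 (Nat.leb_gt (S (N + d)) N)) by lia.
      unfold plus; simpl; ring. }
  assert (Hdelta : forall M x, sum_n (fun j => (if (j =? m)%nat then a else 0)
      * cos (INR (2 * j + 1) * x)) M
      = if (m <=? M)%nat then a * cos (INR (2 * m + 1) * x) else 0).
  { intros M x; induction M as [|M IHM].
    - rewrite sum_O; destruct m; simpl; ring.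
    - rewrite sum_Sn, IHM; unfold plus; cbn [AbelianMonoid.plus].
      destruct (Nat.leb_spec m M), (Nat.eqb_spec (S M) m), (Nat.leb_spec m (S M));
        try lia; subst; simpl plus; unfold plus; simpl; ring. }
  exists (N + m)%nat, (fun j => (if (j =? m)%nat then a else 0)
     + (if (j <=? N)%nat then u j else 0)).
  intros x; rewrite H, <- (Hpad m x).
  replace (a * cos (INR (2 * m + 1) * x)) with
    (sum_n (fun j => (if (j =? m)%nat then a else 0)
      * cos (INR (2 * j + 1) * x)) (N + m)).
  + rewrite <- (sum_n_plus (G := R_AbelianMonoid)).
    apply sum_n_ext; intros j; unfold plus; simpl; ring.
  + rewrite Hdelta, (proj2 (Nat.leb_le m (N + m))) by lia; reflexivity.
Qed.

(** * Completeness of the cosines *)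

Lemma cont_eps (f : R -> R) (x e : R) :
  cont f -> 0 < e -> exists d, 0 < d /\ forall y, Rabs (y - x) < d -> Rabs (f y - f x) < e.
Proof.
intros Hf He.
destruct (proj1 (filterlim_locally f (f x)) (Hf x) (mkposreal e He)) as [d Hd].
exists d; split; [apply cond_pos|]; intros y Hy; exact (Hd y Hy).
Qed.

Lemma mean_trig_zero (b : bool) (f T : R -> R) :
  cont f -> (forall k, cosc f k = 0) -> trig b T -> mean (fun x => f x * T x) = 0.
Proof.
intros Hf H0 HT; induction HT as [T H | a k T g Hk HT IH H].
- rewrite (mean_ext _ (fun _ => 0)) by (intros; rewrite H; ring); apply mean_const.
- pose proof (trig_cont _ _ HT).
  rewrite (mean_ext _ (fun x => a * (f x * cos (INR k * x)) + f x * T x))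
    by (intros; rewrite H; ring).
  rewrite mean_plus, mean_scal, IH by auto using cont_scal, cont_mult, cont_cos.
  fold (cosc f k); rewrite H0; ring.
Qed.

(** Expanding one factor of the power replaces [T] by multiples of [T], [cos x * T] and
    [cos x * (cos x * T)]. The middle one has the other parity, so the induction runs over all [b]
    and [T]. *)
Lemma mean_quadratic_pow_zero (b : bool) (f T : R -> R) (u v w : R) (n : nat) :
  cont f -> (forall k, cosc f k = 0) -> trig b T ->
  mean (fun x => f x * T x * (u + v * cos x + w * (cos x * cos x)) ^ n) = 0.
Proof.
intros Hf H0; revert b T; induction n as [|n IH]; intros b T HT.
- rewrite (mean_ext _ (fun x => f x * T x)) by (intros; simpl; ring).
  now apply (mean_trig_zero b).
- assert (E1 : forall S, trig b S -> trig (negb b) (fun x => cos x * S x)).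
  { intros S HS; apply (trig_ext _ (fun x => cos (INR 1 * x) * S x)).
    - intros x; simpl; now rewrite Rmult_1_l.
    - exact (trig_mult_cos b 1 S HS). }
  assert (E2 : trig b (fun x => cos x * (cos x * T x))).
  { apply (trig_ext _ (fun x => cos (INR 1 * x) * (cos x * T x))).
    - intros x; simpl; now rewrite Rmult_1_l.
    - rewrite <- (negb_involutive b); exact (trig_mult_cos _ 1 _ (E1 T HT)). }
  pose proof (trig_cont _ _ HT) as CT.
  assert (Cc : cont cos) by exact continuous_cos.
  assert (CP : cont (fun x => (u + v * cos x + w * (cos x * cos x)) ^ n))
    by auto 6 using cont_pow, cont_plus, cont_scal, cont_mult, cont_const.
  rewrite (mean_ext _ (fun x =>
    u * (f x * T x * (u + v * cos x + w * (cos x * cos x)) ^ n)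
    + (v * (f x * (cos x * T x) * (u + v * cos x + w * (cos x * cos x)) ^ n)
    + w * (f x * (cos x * (cos x * T x)) * (u + v * cos x + w * (cos x * cos x)) ^ n))))
    by (intros; simpl; ring).
  rewrite 2!mean_plus, 3!mean_scal by auto 8 using cont_plus, cont_scal, cont_mult.
  rewrite (IH b), (IH (negb b)), (IH b) by auto; ring.
Qed.

(* If f(t) > 0, the powers of the polynomial [1 + kappa^2/4 - (cos x - cos t)^2 / 4],
   which exceeds 1 only near t and -t, make the mean of f times it diverge. *)
Lemma cosc_zero_nonpos (f : R -> R) (t : R) :
  cont f -> periodic f -> even_fun f -> (forall k, cosc f k = 0) ->
  0 < t < PI -> f t <= 0.
Proof.
intros Hf Hper Hev H0 Ht; apply Rnot_lt_le; intros Hpos.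
destruct (cont_eps f t (f t / 2) Hf ltac:(lra)) as (d0 & Hd0 & Hfd).
(* The interval from [t - d] to [t + d] stays within [[0, PI]] and where [f] exceeds [f t / 2]. *)
set (d := Rmin (d0 / 2) (Rmin t (PI - t))).
assert (Hd : 0 < d /\ d < d0 /\ d <= t /\ d <= PI - t).
{ unfold d, Rmin; repeat destruct Rle_dec; lra. }
(* As [cos] decreases on [[0, PI]], a point [x] there with [|cos x - cos t| < kappa] must lie in
   this interval. *)
set (kappa := Rmin (cos (t - d) - cos t) (cos t - cos (t + d))).
assert (Hk1 : kappa <= cos (t - d) - cos t) by apply Rmin_l.
assert (Hk2 : kappa <= cos t - cos (t + d)) by apply Rmin_r.
assert (Hk : 0 < kappa).
{ apply Rmin_pos; apply Rlt_0_minus; apply cos_decreasing_1; lra. }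
assert (Hin0 : forall x, 0 <= x <= PI -> Rabs (cos x - cos t) < kappa -> f t / 2 <= f x).
{ intros x Hx Hc; apply Rabs_def2 in Hc.
  destruct (Rle_lt_dec x (t - d)) as [L|L].
  { pose proof (cos_decr_1 x (t - d)); lra. }
  destruct (Rle_lt_dec (t + d) x) as [L'|L'].
  { pose proof (cos_decr_1 (t + d) x); lra. }
  pose proof (Hfd x) as Hx'; apply Rabs_def2 in Hx'; [lra | apply Rabs_def1; lra]. }
assert (Hin : forall x, 0 <= x <= 2 * PI -> Rabs (cos x - cos t) < kappa -> f t / 2 <= f x).
{ intros x Hx Hc; destruct (Rle_lt_dec x PI) as [L|L]; [apply Hin0; auto; lra|].
  assert (Ef : f x = f (- x + 2 * PI)) by (now rewrite Hper, Hev).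
  rewrite Ef; apply Hin0; [lra|].
  replace (- x + 2 * PI) with (- x + 2 * INR 1 * PI) by (simpl; ring).
  now rewrite cos_period, cos_neg. }
destruct (continuity_ab_maj (fun x => - f x) 0 (2 * PI)) as (xM & HM & _).
{ lra. }
{ intros x _; apply continuity_pt_filterlim; exact (continuous_opp f x (Hf x)). }
set (M := Rmax 0 (- f xM)).
assert (HM0 : 0 <= M) by apply Rmax_l.
assert (HMf : forall x, 0 <= x <= 2 * PI -> - M <= f x).
{ intros x Hx; pose proof (HM x Hx); pose proof (Rmax_r 0 (- f xM)) as Hr; fold M in Hr; lra. }
set (T := fun x => 1 + kappa ^ 2 / 4 - (cos x - cos t) ^ 2 / 4).
(* Two cosines differ by at most 2, so the subtracted term is at most 1. *)
assert (HT0 : forall x, 0 <= T x).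
{ intros x; unfold T; pose proof (COS_bound x); pose proof (COS_bound t).
  assert (0 <= (2 - (cos x - cos t)) * (2 + (cos x - cos t))) by (apply Rmult_le_pos; lra).
  pose proof (pow2_ge_0 kappa); nra. }
destruct (cont_eps cos t (kappa / 2) continuous_cos ltac:(lra)) as (d1 & Hd1 & Hcd).
set (e := Rmin d1 d).
assert (He : 0 < e /\ e <= d1 /\ e <= d).
{ unfold e, Rmin; destruct Rle_dec; lra. }
(* This is [kappa^2 / 4 - (kappa / 2)^2 / 4], a lower bound for [T - 1] where
   [|cos x - cos t| < kappa / 2]. *)
set (h := 3 / 16 * kappa ^ 2).
assert (Hh : 0 < h) by (unfold h; pose proof (pow_lt kappa 2 Hk); lra).
(* Where [cos x] is close to [cos t], [f] is nonnegative; elsewhere [T <= 1], so negative values of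
   [f] are not amplified. *)
assert (Hlow : forall n x, 0 <= x <= 2 * PI -> - M <= f x * T x ^ n).
{ intros n x Hx; pose proof (pow_le (T x) n (HT0 x)) as Hp.
  destruct (Rlt_le_dec (Rabs (cos x - cos t)) kappa) as [L|L].
  - pose proof (Hin x Hx L); assert (0 <= f x * T x ^ n) by (apply Rmult_le_pos; lra); lra.
  - assert (HT1 : T x <= 1).
    { unfold T; rewrite <- (pow2_abs (cos x - cos t)).
      pose proof (pow_incr kappa (Rabs (cos x - cos t)) 2); lra. }
    pose proof (pow_incr (T x) 1 n (conj (HT0 x) HT1)) as Hp1; rewrite pow1 in Hp1.
    pose proof (HMf x Hx); nra. }
(* Bernoulli's inequality bounds [(1 + h)^n] from below by a linear function of [n]. *)
assert (Hpeak : forall n x, t - e < x < t + e -> f t / 2 * (1 + INR n * h) <= f x * T x ^ n).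
{ intros n x Hx.
  assert (Hc : Rabs (cos x - cos t) < kappa / 2) by (apply Hcd, Rabs_def1; lra).
  assert (Hfx : f t / 2 <= f x) by (apply Hin; lra).
  assert (HTx : 1 + h <= T x).
  { unfold T, h; rewrite <- (pow2_abs (cos x - cos t)).
    pose proof (pow_incr (Rabs (cos x - cos t)) (kappa / 2) 2) as Hp.
    pose proof (Rabs_pos (cos x - cos t)); lra. }
  apply Rmult_le_compat; try lra.
  - pose proof (pos_INR n); nra.
  - apply Rle_trans with ((1 + h) ^ n); [now apply poly | apply pow_incr; lra]. }
assert (CT : forall n, cont (fun x => f x * T x ^ n)).
{ intros n; apply cont_mult, cont_pow; auto; unfold T.
  apply cont_minus; [apply cont_const|].
  intros x; apply (continuous_ext (fun x => / 4 * (cos x - cos t) ^ 2)); [intros; simpl; field|].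
  apply cont_scal, cont_pow, cont_minus; [exact continuous_cos | apply cont_const]. }
(* [T] is a quadratic polynomial in [cos x]; the cosine of frequency 0 serves as the constant factor
   1. *)
assert (Hzero : forall n, RInt (fun x => f x * T x ^ n) 0 (2 * PI) = 0).
{ intros n; pose proof PI_RGT_0.
  assert (E : mean (fun x => f x * T x ^ n) = 0).
  { rewrite <- (mean_quadratic_pow_zero false f (fun x => cos (INR 0 * x))
      (1 + kappa ^ 2 / 4 - cos t ^ 2 / 4) (cos t / 2) (- / 4) n Hf H0 (trig_cos 0)).
    apply mean_ext; intros x; simpl INR; rewrite Rmult_0_l, cos_0, Rmult_1_r.
    f_equal; f_equal; unfold T; field. }
  unfold mean in E; apply Rmult_integral in E; destruct E as [E|E]; auto.
  exfalso; revert E; apply Rinv_neq_0_compat; lra. }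
(* The peak contributes at least the left side; the rest of the period is shorter than [2 PI] and
   costs at most [M] per unit length. *)
assert (Hint : forall n, 2 * e * (f t / 2 * (1 + INR n * h)) <= 2 * PI * M).
{ intros n; pose proof PI_RGT_0.
  pose proof (Hzero n) as HZ.
  set (F := fun x => f x * T x ^ n) in *.
  assert (IF : forall a b, ex_RInt F a b) by (intros; apply cont_ex_RInt; exact (CT n)).
  rewrite <- (RInt_Chasles F 0 (t - e) (2 * PI)) in HZ by auto.
  rewrite <- (RInt_Chasles F (t - e) (t + e) (2 * PI)) in HZ by auto.
  assert (G : forall a b m, a <= b -> (forall x, a < x < b -> m <= F x) -> (b - a) * m <= RInt F a b).
  { intros a b m Hab Hm.
    replace ((b - a) * m) with (RInt (fun _ => m) a b) by (now rewrite RInt_const).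
    apply RInt_le; auto; apply ex_RInt_const. }
  pose proof (G 0 (t - e) (- M) ltac:(lra) ltac:(intros; apply Hlow; lra)).
  pose proof (G (t - e) (t + e) _ ltac:(lra) (Hpeak n)).
  pose proof (G (t + e) (2 * PI) (- M) ltac:(lra) ltac:(intros; apply Hlow; lra)).
  unfold plus in HZ; simpl in HZ; nra. }
destruct (INR_archimed (e * f t * h) (2 * PI * M)) as [n Hn].
{ repeat apply Rmult_lt_0_compat; lra. }
specialize (Hint n); assert (0 < e * f t) by (apply Rmult_lt_0_compat; lra); nra.
Qed.

Lemma periodic_Z (f : R -> R) (z : Z) (x : R) :
  periodic f -> f (x + IZR z * (2 * PI)) = f x.
Proof.
intros Hf.
assert (Hn : forall n y, f (y + INR n * (2 * PI)) = f y).
{ induction n as [|n IH]; intros y.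
  - f_equal; simpl; ring.
  - rewrite <- (IH y), <- (Hf (y + INR n * (2 * PI))); f_equal; rewrite S_INR; ring. }
destruct (Z_le_gt_dec 0 z) as [L|L].
- rewrite <- (Hn (Z.to_nat z) x); do 2 f_equal.
  now rewrite INR_IZR_INZ, Z2Nat.id.
- rewrite <- (Hn (Z.to_nat (- z)) (x + IZR z * (2 * PI))); f_equal.
  rewrite INR_IZR_INZ, Z2Nat.id, opp_IZR by lia; ring.
Qed.

(** Whole periods are subtracted, then the point is reflected by [t -> 2 PI - t] if it exceeds
    [PI]. *)
Lemma periodic_even_reduce (f : R -> R) (x : R) :
  periodic f -> even_fun f -> exists t, 0 <= t <= PI /\ f x = f t.
Proof.
intros Hp He; pose proof PI_RGT_0.
destruct (floor_ex (x / (2 * PI))) as [z Hz].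
assert (Hx : x = x / (2 * PI) * (2 * PI)) by (field; lra).
set (t := x + IZR (- z) * (2 * PI)).
assert (Ht : 0 <= t < 2 * PI).
{ unfold t; rewrite opp_IZR; split; nra. }
assert (E : f x = f t) by (unfold t; now rewrite periodic_Z).
destruct (Rle_lt_dec t PI) as [L|L].
- exists t; split; [lra | exact E].
- exists (- t + 2 * PI); split; [lra|]; now rewrite Hp, He.
Qed.

(** The one-sided bound for [f] and [- f] gives zero inside [(0, PI)]; continuity adds the end
    points, evenness and periodicity the rest of the line. *)
Lemma cosc_complete (f : R -> R) :
  cont f -> periodic f -> even_fun f -> (forall k, cosc f k = 0) -> forall x, f x = 0.
Proof.
intros Hf Hp He H0 x; pose proof PI_RGT_0.
assert (Hint : forall t, 0 < t < PI -> f t = 0).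
{ intros t Ht; apply Rle_antisym; [now apply cosc_zero_nonpos|].
  enough (- f t <= 0) by lra.
  apply (cosc_zero_nonpos (fun x => - f x)); auto.
  - intros y; exact (continuous_opp f y (Hf y)).
  - intros y; now rewrite Hp.
  - intros y; now rewrite He.
  - intros k; rewrite (cosc_ext _ (fun x => (-1) * f x)) by (intros; ring).
    rewrite cosc_scal, H0 by auto; ring. }
destruct (periodic_even_reduce f x Hp He) as (t & Ht & ->).
apply NNPP; intros Hne.
destruct (cont_eps f t (Rabs (f t)) Hf ltac:(now apply Rabs_pos_lt)) as (d & Hd & Hc).
assert (Hex : exists s, 0 < s < PI /\ Rabs (s - t) < d).
{ pose proof (Rmin_l (d / 2) 1); pose proof (Rmin_r (d / 2) 1); pose proof PI2_1.
  assert (0 < Rmin (d / 2) 1) by (apply Rmin_pos; lra).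
  destruct (Rle_lt_dec t (PI / 2)).
  - exists (t + Rmin (d / 2) 1); split; [lra | apply Rabs_def1; lra].
  - exists (t - Rmin (d / 2) 1); split; [lra | apply Rabs_def1; lra]. }
destruct Hex as (s & Hs & Hsd); specialize (Hc s Hsd).
rewrite (Hint s Hs), Rminus_0_l, Rabs_Ropp in Hc; lra.
Qed.

(** * Series expansions *)

(** Both suprema are bounded below by values they dominate, so neither is minus infinity. This
    matters because [Rbar_plus] sends a sum of opposite infinities to 0, which would look finite. *)
Lemma holder_norm_finite (beta : R) (f : R -> R) :
  Rbar_lt (holder_norm beta f) p_infty ->
  exists A B, holder_norm beta f = Finite (A + B) /\ 0 <= A /\ 0 <= B /\
    (forall x, Rabs (f x) <= A) /\
    (forall x y, x <> y -> Rabs (f x - f y) <= B * Rpower (Rabs (x - y)) beta).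
Proof.
unfold holder_norm.
set (E1 := fun q => exists x, q = Rabs (f x)).
set (E2 := fun q => exists x y, x <> y /\ q = Rabs (f x - f y) / Rpower (Rabs (x - y)) beta).
intros H.
assert (H1 : forall x, Rbar_le (Rabs (f x)) (Lub_Rbar E1)).
{ intros x; apply (proj1 (Lub_Rbar_correct E1)); now exists x. }
assert (H2 : forall x y, x <> y ->
  Rbar_le (Rabs (f x - f y) / Rpower (Rabs (x - y)) beta) (Lub_Rbar E2)).
{ intros x y Hxy; apply (proj1 (Lub_Rbar_correct E2)); now exists x, y. }
pose proof (H1 0) as H10; pose proof (H2 0 1 ltac:(lra)) as H20.
destruct (Lub_Rbar E1) as [A| |], (Lub_Rbar E2) as [B| |]; simpl in *; try easy.
assert (HR : forall z, 0 < Rpower z beta) by (intros; apply exp_pos).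
exists A, B; repeat split; auto.
- apply Rle_trans with (2 := H10), Rabs_pos.
- apply Rle_trans with (2 := H20).
  apply Rmult_le_pos; [apply Rabs_pos | apply Rlt_le, Rinv_0_lt_compat, HR].
- intros x y Hxy; specialize (H2 x y Hxy); specialize (HR (Rabs (x - y))).
  apply Rmult_le_reg_r with (/ Rpower (Rabs (x - y)) beta); [now apply Rinv_0_lt_compat|].
  rewrite Rmult_assoc, Rinv_r, Rmult_1_r by lra; exact H2.
Qed.

Lemma holder_norm_sup (beta : R) (f : R -> R) (e : R) :
  Rbar_lt (holder_norm beta f) e -> forall x, Rabs (f x) <= e.
Proof.
intros H x.
destruct (holder_norm_finite beta f) as (A & B & E & HA & HB & Hs & _).
- now apply Rbar_lt_trans with e.
- rewrite E in H; simpl in H; specialize (Hs x); lra.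
Qed.

Lemma holder_norm_scal (beta a : R) (f : R -> R) :
  Rbar_lt (holder_norm beta f) p_infty ->
  Rbar_lt (holder_norm beta (fun x => f x * a)) p_infty.
Proof.
intros H; destruct (holder_norm_finite _ _ H) as (A & B & _ & HA & HB & Hs & Hh).
pose proof (Rabs_pos a) as Ha; unfold holder_norm.
apply Rbar_le_lt_trans with (Rbar_plus (A * Rabs a) (B * Rabs a)); [|exact I].
apply Rbar_plus_le_compat.
- apply Lub_Rbar_correct; intros q [x ->]; simpl.
  rewrite Rabs_mult; now apply Rmult_le_compat_r.
- apply Lub_Rbar_correct; intros q (x & y & Hxy & ->); simpl.
  assert (HR : 0 < Rpower (Rabs (x - y)) beta) by apply exp_pos.
  rewrite <- Rmult_minus_distr_r, Rabs_mult.
  apply Rmult_le_reg_r with (Rpower (Rabs (x - y)) beta); auto.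
  unfold Rdiv; rewrite Rmult_assoc, Rinv_l, Rmult_1_r by lra.
  specialize (Hh x y Hxy).
  apply Rmult_le_compat_r with (r := Rabs a) in Hh; lra.
Qed.

Lemma holder_cont (beta : R) (f : R -> R) :
  0 < beta -> Rbar_lt (holder_norm beta f) p_infty -> cont f.
Proof.
intros Hb H x.
destruct (holder_norm_finite beta f H) as (A & B & _ & HA & HB & _ & Hh).
apply filterlim_locally; intros eps.
(* The admissible distance will be [q^(1 / beta)]; [B + 1] avoids dividing by zero. *)
set (q := eps / (B + 1)).
assert (Hq : 0 < q) by (apply Rdiv_lt_0_compat; [apply cond_pos | lra]).
assert (Hd : 0 < Rpower q (/ beta)) by apply exp_pos.
exists (mkposreal _ Hd); intros y Hy.
change (Rabs (y - x) < Rpower q (/ beta)) in Hy; change (Rabs (f y - f x) < eps).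
destruct (Req_dec y x) as [->|N]; [rewrite Rminus_diag, Rabs_R0; apply cond_pos|].
assert (Hp : Rpower (Rabs (y - x)) beta < q).
{ rewrite <- (Rpower_1 q Hq), <- (Rinv_l beta), <- Rpower_mult by lra.
  apply Rlt_Rpower_l; [lra|]; split; [apply Rabs_pos_lt; lra | exact Hy]. }
specialize (Hh y x N); pose proof (exp_pos (beta * ln (Rabs (y - x)))) as Hpos.
fold (Rpower (Rabs (y - x)) beta) in Hpos.
apply Rle_lt_trans with (1 := Hh).
apply Rlt_le_trans with ((B + 1) * q); [nra|].
right; unfold q; field; lra.
Qed.

(** * Power series in the bifurcation parameter *)

Lemma CV_radius_of_disk (a : nat -> R) (d s : R) :
  (forall t, Rabs t < d -> ex_pseries a t) -> Rabs s < d -> Rbar_lt (Rabs s) (CV_radius a).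
Proof.
intros H Hs; pose proof (Rabs_pos s).
(* The midpoint of [|s|] and [d] still lies in the disk of convergence; were it beyond the radius,
   the terms there would not tend to 0. *)
apply Rbar_lt_le_trans with ((Rabs s + d) / 2); [simpl; lra|].
apply Rbar_not_lt_le; intros Hlt.
assert (Ht : Rabs ((Rabs s + d) / 2) = (Rabs s + d) / 2) by (apply Rabs_pos_eq; lra).
apply (CV_disk_outside a ((Rabs s + d) / 2)); [now rewrite Ht|].
apply ex_series_lim_0.
destruct (H ((Rabs s + d) / 2)) as [l Hl]; [rewrite Ht; lra|].
exists l; now apply is_pseries_R.
Qed.

(** Identity theorem for power series: this is how powers of [s] are equated. *)
Lemma pseries_zero (a : nat -> R) (d : R) :
  0 < d -> (forall s, Rabs s < d -> is_pseries a s 0) -> forall n, a n = 0.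
Proof.
intros Hd H n.
assert (Hr : Rbar_lt 0 (CV_radius a)).
{ rewrite <- Rabs_R0; apply CV_radius_of_disk with d; [|now rewrite Rabs_R0].
  intros t Ht; exists 0; now apply H. }
apply (PSeries_ext_recip a (fun _ => 0) n Hr).
- rewrite CV_radius_const_0; exact I.
- exists (mkposreal d Hd); intros s Hs.
  rewrite PSeries_const_0; apply is_pseries_unique, H.
  change (Rabs (s - 0) < d) in Hs; now rewrite Rminus_0_r in Hs.
Qed.

Lemma is_series_tail_geom (a : nat -> R) (l M q : R) (N : nat) :
  0 <= q < 1 -> (forall n, Rabs (a n) <= M * q ^ n) -> is_series a l ->
  Rabs (l - sum_n a N) <= M * q ^ S N / (1 - q).
Proof.
intros Hq Ha Hl.
assert (Hs : is_series (fun k => a (S N + k)%nat) (l - sum_n a N)).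
{ apply is_series_incr_n; [lia|]; simpl.
  assert (E : l - sum_n a N + sum_n a N = l) by ring.
  change (is_series a (l - sum_n a N + sum_n a N)); now rewrite E. }
assert (Hg : is_series (fun k => M * q ^ S N * q ^ k) (M * q ^ S N * / (1 - q))).
{ apply (is_series_scal (V := R_NormedModule) (M * q ^ S N)).
  apply is_series_geom; rewrite Rabs_pos_eq; lra. }
assert (Hb : forall k, Rabs (a (S N + k)%nat) <= M * q ^ S N * q ^ k).
{ intros k; rewrite Rmult_assoc, <- pow_add; apply Ha. }
rewrite <- (is_series_unique _ _ Hs).
unfold Rdiv; rewrite <- (is_series_unique _ _ Hg).
assert (Hex : ex_series (fun k => Rabs (a (S N + k)%nat))).
{ apply (ex_series_le (V := R_CompleteNormedModule)) with (2 := ex_intro _ _ Hg).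
  intros k; change (Rabs (Rabs (a (S N + k)%nat)) <= M * q ^ S N * q ^ k); now rewrite Rabs_Rabsolu. }
apply Rle_trans with (1 := Series_Rabs _ Hex).
apply Series_le; [|now eexists; exact Hg].
intros k; split; [apply Rabs_pos | apply Hb].
Qed.

(** The cosine coefficient is bounded by the supremum norm, so it passes through uniform limits. *)
Lemma is_series_cosc (v : nat -> R -> R) (f : R -> R) (k : nat) :
  (forall l, cont (v l)) -> cont f ->
  (forall eps, 0 < eps ->
     eventually (fun N => forall x, Rabs (f x - sum_n (fun l => v l x) N) <= eps)) ->
  is_series (fun l => cosc (v l) k) (cosc f k).
Proof.
intros Hv Hf H; apply filterlim_locally; intros eps.
destruct (H (eps / 2)) as [N0 HN]; [pose proof (cond_pos eps); lra|].
exists N0; intros N HN'.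
change (Rabs (sum_n (fun l => cosc (v l) k) N - cosc f k) < eps).
rewrite Rabs_minus_sym, <- cosc_sum_n, <- cosc_minus by auto using cont_sum_n.
apply Rle_lt_trans with (eps / 2); [|pose proof (cond_pos eps); lra].
apply cosc_bound; auto using cont_minus, cont_sum_n.
Qed.

(** Since [M] and [K] do not depend on [x], the convergence is uniform in [x] for each [s] with
    [|s| < 1 / K], so cosine coefficients may be taken termwise. Such geometric bounds survive
    Cauchy products. *)
Definition expands (F : R -> R -> R) (u : nat -> R -> R) : Prop :=
  exists M K, 0 <= M /\ 0 < K /\
  (forall l x, Rabs (u l x) <= M * K ^ l) /\
  (forall s x, Rabs s * K < 1 -> is_pseries (fun l => u l x) s (F s x)).

Lemma geom_CV_radius (a : nat -> R) (M K s : R) :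
  0 < K -> (forall l, Rabs (a l) <= M * K ^ l) -> Rabs s * K < 1 ->
  Rbar_lt (Rabs s) (CV_radius a).
Proof.
intros HK Ha Hs; apply Rbar_lt_le_trans with (/ K).
- simpl; apply Rmult_lt_reg_r with K; auto; rewrite Rinv_l; lra.
- apply (proj1 (CV_radius_bounded a)); exists M; intros n.
  assert (0 < K ^ n) by now apply pow_lt.
  rewrite Rabs_mult, (Rabs_pos_eq ((/ K) ^ n)), pow_inv
    by (apply pow_le, Rlt_le, Rinv_0_lt_compat; lra).
  apply Rmult_le_reg_r with (K ^ n); auto.
  rewrite Rmult_assoc, Rinv_l, Rmult_1_r by lra; apply Ha.
Qed.

(** Each of the [l + 1] products is at most [M M' K^l] in absolute value, and [l + 1 <= 2^l] is
    absorbed by doubling the ratio. *)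
Lemma PS_mult_geom_bound (a b : nat -> R) (M M' K : R) (l : nat) :
  0 <= M -> 0 <= M' -> 0 < K ->
  (forall i, Rabs (a i) <= M * K ^ i) -> (forall i, Rabs (b i) <= M' * K ^ i) ->
  Rabs (PS_mult a b l) <= M * M' * (2 * K) ^ l.
Proof.
intros HM HM' HK Ha Hb; unfold PS_mult.
apply Rle_trans with (1 := Rsum_abs _ _).
apply Rle_trans with (sum_f_R0 (fun _ => M * M' * K ^ l) l).
- apply sum_Rle; intros i Hi; rewrite Rabs_mult.
  replace (K ^ l) with (K ^ i * K ^ (l - i)) by (rewrite <- pow_add; f_equal; lia).
  replace (M * M' * (K ^ i * K ^ (l - i))) with ((M * K ^ i) * (M' * K ^ (l - i))) by ring.
  apply Rmult_le_compat; auto using Rabs_pos.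
- rewrite sum_cte, Rpow_mult_distr.
  assert (H2 : INR (S l) <= 2 ^ l).
  { clear; induction l as [|l IH]; [simpl; lra|].
    rewrite S_INR; simpl pow; pose proof (pow_R1_Rle 2 l); lra. }
  assert (0 <= M * M' * K ^ l).
  { apply Rmult_le_pos; [now apply Rmult_le_pos | apply pow_le; lra]. }
  nra.
Qed.

Lemma expands_mult (F G : R -> R -> R) (u v : nat -> R -> R) :
  expands F u -> expands G v ->
  expands (fun s x => F s x * G s x)
    (fun l x => PS_mult (fun i => u i x) (fun i => v i x) l).
Proof.
intros (M & K & HM & HK & Hu & HF) (M' & K' & HM' & HK' & Hv & HG).
set (L := Rmax K K').
assert (HL1 : K <= L) by apply Rmax_l.
assert (HL2 : K' <= L) by apply Rmax_r.
assert (Hu' : forall l x, Rabs (u l x) <= M * L ^ l).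
{ intros l x; apply Rle_trans with (1 := Hu l x), Rmult_le_compat_l; auto.
  apply pow_incr; lra. }
assert (Hv' : forall l x, Rabs (v l x) <= M' * L ^ l).
{ intros l x; apply Rle_trans with (1 := Hv l x), Rmult_le_compat_l; auto.
  apply pow_incr; lra. }
exists (M * M'), (2 * L); repeat split; [now apply Rmult_le_pos | lra | |].
- intros l x; apply PS_mult_geom_bound; auto; lra.
- intros s x Hs; pose proof (Rabs_pos s).
  apply is_pseries_mult; [apply HF; nra | apply HG; nra | |].
  + apply geom_CV_radius with M L; auto; [lra | nra].
  + apply geom_CV_radius with M' L; auto; [lra | nra].
Qed.

Lemma is_pseries_monomial (n : nat) (a s : R) :
  is_pseries (fun l => if (l =? n)%nat then a else 0) s (a * s ^ n).
Proof.
apply is_pseries_R.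
assert (E : forall N : nat, sum_n (fun l => (if (l =? n)%nat then a else 0) * s ^ l) N
  = if (n <=? N)%nat then a * s ^ n else 0).
{ induction N as [|N IH].
  - rewrite sum_O; destruct n; simpl; ring.
  - rewrite sum_Sn, IH.
    destruct (Nat.leb_spec n N), (Nat.eqb_spec (S N) n), (Nat.leb_spec n (S N));
      try lia; subst; unfold plus; simpl; ring. }
apply filterlim_ext_loc with (fun _ : nat => a * s ^ n); [|apply filterlim_const].
exists n; intros N HN; now rewrite E, (proj2 (Nat.leb_le n N)).
Qed.

(** Coefficient of [s^l] in the [q]-th power of the formal series with coefficients [u]. *)
Fixpoint cauchy_pow (u : nat -> R -> R) (q l : nat) (x : R) : R :=
  match q with
  | O => if (l =? 0)%nat then 1 else 0
  | S q => PS_mult (fun i => u i x) (fun i => cauchy_pow u q i x) l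
  end.

Lemma expands_pow (F : R -> R -> R) (u : nat -> R -> R) (q : nat) :
  expands F u -> expands (fun s x => F s x ^ q) (cauchy_pow u q).
Proof.
intros H; induction q as [|q IH]; [|exact (expands_mult _ _ _ _ H IH)].
exists 1, 1; repeat split; try lra.
- intros [|l] x; simpl; [rewrite Rabs_R1; lra|].
  rewrite Rabs_R0, pow1; lra.
- intros s x _; replace (F s x ^ 0) with (1 * s ^ 0) by (simpl; ring).
  exact (is_pseries_monomial 0 1 s).
Qed.

Lemma cauchy_pow_cont (u : nat -> R -> R) (q l : nat) :
  (forall i, cont (u i)) -> cont (cauchy_pow u q l).
Proof.
intros Hu; revert l; induction q as [|q IH]; intros l.
- exact (cont_const _).
- intros x.
  apply continuous_ext with
    (fun x => sum_n (fun i => u i x * cauchy_pow u q (l - i) x) l).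
  + intros y; now rewrite sum_n_Reals.
  + apply (cont_sum_n (fun i x => u i x * cauchy_pow u q (l - i) x)).
    intros i; now apply cont_mult.
Qed.

Lemma expands_cosc (F : R -> R -> R) (u : nat -> R -> R) (r : R) (k : nat) :
  0 < r -> (forall l, cont (u l)) -> (forall s, Rabs s < r -> cont (F s)) -> expands F u ->
  exists d, 0 < d /\ d <= r /\ forall s, Rabs s < d ->
    is_pseries (fun l => cosc (u l) k) s (cosc (F s) k).
Proof.
intros Hr Cu CF (M & K & HM & HK & Hu & HF).
(* Below [1 / K] the tails are dominated by geometric ones, uniformly in [x]; below [r] the function
   [F s] is continuous. *)
exists (Rmin r (/ K)).
split; [apply Rmin_pos; auto; now apply Rinv_0_lt_compat|].
split; [apply Rmin_l|].
intros s Hs.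
assert (Hsr : Rabs s < r) by (apply Rlt_le_trans with (1 := Hs), Rmin_l).
assert (HsK : Rabs s * K < 1).
{ rewrite <- (Rinv_l K) by lra; apply Rmult_lt_compat_r; auto.
  apply Rlt_le_trans with (1 := Hs), Rmin_r. }
assert (Hq : 0 <= Rabs s * K < 1).
{ split; auto; apply Rmult_le_pos; [apply Rabs_pos | lra]. }
apply is_pseries_R.
apply is_series_ext with (fun l => cosc (fun x => s ^ l * u l x) k).
{ intros l; rewrite cosc_scal; auto; apply Rmult_comm. }
apply is_series_cosc; auto using cont_scal.
intros eps Heps.
assert (Hlim : is_lim_seq (fun N => M * (Rabs s * K) ^ S N / (1 - Rabs s * K)) 0).
{ replace (Finite 0) with (Rbar_mult (M / (1 - Rabs s * K)) 0)
    by (change (Finite (M / (1 - Rabs s * K) * 0) = 0); now rewrite Rmult_0_r).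
  apply is_lim_seq_ext with (fun N => M / (1 - Rabs s * K) * (Rabs s * K) ^ S N).
  - intros N; field; lra.
  - apply is_lim_seq_scal_l, (is_lim_seq_incr_1 (fun n => (Rabs s * K) ^ n)).
    apply is_lim_seq_geom; rewrite Rabs_pos_eq; lra. }
apply is_lim_seq_spec in Hlim.
destruct (Hlim (mkposreal eps Heps)) as [N0 HN0]; exists N0; intros N HN x.
specialize (HN0 N HN); simpl pos in HN0; rewrite Rminus_0_r in HN0.
apply Rle_trans with (M * (Rabs s * K) ^ S N / (1 - Rabs s * K)).
- apply is_series_tail_geom; auto.
  + intros n; rewrite Rabs_mult, <- RPow_abs, Rpow_mult_distr.
    pose proof (Hu n x); pose proof (pow_le (Rabs s) n (Rabs_pos s)); nra.
  + apply is_series_ext with (fun l => u l x * s ^ l); [intros; apply Rmult_comm|].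
    now apply is_pseries_R, HF.
- pose proof (Rle_abs (M * (Rabs s * K) ^ S N / (1 - Rabs s * K))); lra.
Qed.

Lemma holder_series_sup (beta : R) (u : nat -> R -> R) (f : R -> R) :
  is_holder_series beta u f -> forall eps, 0 < eps ->
  eventually (fun N => forall x, Rabs (f x - sum_n (fun l => u l x) N) <= eps).
Proof.
intros H eps Heps; destruct (H eps Heps) as [N0 HN]; exists N0; intros N HN' x.
exact (holder_norm_sup _ _ _ (HN N HN') x).
Qed.

Lemma holder_series_pointwise (beta : R) (u : nat -> R -> R) (f : R -> R) (x : R) :
  is_holder_series beta u f -> is_series (fun l => u l x) (f x).
Proof.
intros H; apply filterlim_locally; intros eps.
destruct (holder_series_sup _ _ _ H (eps / 2)) as [N0 HN0];
  [pose proof (cond_pos eps); lra|].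
exists N0; intros N HN; specialize (HN0 N HN x).
change (Rabs (sum_n (fun l => u l x) N - f x) < eps).
rewrite Rabs_minus_sym; pose proof (cond_pos eps); lra.
Qed.

(** A late term is the difference of two partial sums within 1 of [f], hence at most 2; each of the
    finitely many others has finite norm. *)
Lemma holder_series_terms_bounded (beta : R) (u : nat -> R -> R) (f : R -> R) :
  (forall l, Rbar_lt (holder_norm beta (u l)) p_infty) -> is_holder_series beta u f ->
  exists M, 0 <= M /\ forall l x, Rabs (u l x) <= M.
Proof.
intros Hu H.
destruct (holder_series_sup _ _ _ H 1 ltac:(lra)) as [N0 HN].
(* [M] is kept at least 2 so that it also bounds the late terms. *)
assert (Hfin : forall N, exists M, 2 <= M /\
  forall l x, (l <= N)%nat -> Rabs (u l x) <= M).
{ induction N as [|N (M & HM & IH)].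
  - destruct (holder_norm_finite _ _ (Hu 0%nat)) as (A & _ & _ & HA & _ & Hs & _).
    exists (2 + A); split; [lra|]; intros l x Hl; replace l with 0%nat by lia.
    specialize (Hs x); lra.
  - destruct (holder_norm_finite _ _ (Hu (S N))) as (A & _ & _ & HA & _ & Hs & _).
    exists (M + A); split; [lra|]; intros l x Hl.
    destruct (Nat.eq_dec l (S N)) as [->|Hne]; [specialize (Hs x); lra|].
    specialize (IH l x ltac:(lia)); lra. }
destruct (Hfin N0) as (M & HM & HM'); exists M; split; [lra|].
intros l x; destruct (le_lt_dec l N0) as [L|L]; auto.
destruct l as [|l]; [lia|].
pose proof (HN l ltac:(lia) x) as H1; pose proof (HN (S l) ltac:(lia) x) as H2.
rewrite sum_Sn in H2; unfold plus in H2; simpl in H2.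
apply Rabs_le_between in H1; apply Rabs_le_between in H2.
apply Rle_trans with 2; auto; apply Rabs_le; lra.
Qed.

(** * Solving the recursion for the coefficients *)

(** The [q]-th power of a series without constant term starts at order [q] or later. *)
Lemma cauchy_pow_vanish (u : nat -> R -> R) (q l : nat) (x : R) :
  u 0%nat x = 0 -> (l < q)%nat -> cauchy_pow u q l x = 0.
Proof.
intros H0; revert l; induction q as [|q IH]; intros l Hl; [lia|].
simpl; unfold PS_mult; apply sum_eq_R0; intros [|i] Hi; [rewrite H0; ring|].
rewrite IH by lia; ring.
Qed.

(* The factors of each product summing to coefficient l of the q-th power have
   indices at least 1, hence less than m. *)
Lemma cauchy_pow_structure (d m : nat) (u : nat -> R -> R) :
  (forall x, u 0%nat x = 0) ->
  (forall i, (i < m)%nat -> trig true (u i)) ->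
  (forall i, (i < m)%nat -> (forall j, i <> (j * d + 1)%nat) -> forall x, u i x = 0) ->
  forall q l, (S l < m + q)%nat ->
    trig (Nat.odd q) (cauchy_pow u q l) /\
    ((forall j, l <> (j * d + q)%nat) -> forall x, cauchy_pow u q l x = 0).
Proof.
intros H0 Ht Hz; induction q as [|q IH]; intros l Hl.
- destruct l as [|l]; split.
  + apply (trig_ext _ (fun x => cos (INR 0 * x))); [|exact (trig_cos 0)].
    intros x; simpl; now rewrite Rmult_0_l, cos_0.
  + intros H; now specialize (H 0%nat).
  + now apply trig_zero.
  + now intros _ x.
(* For [i >= m] the other [q] factors would have total index below [q], so their product
   vanishes. *)
- assert (Hsmall : forall i x, (i <= l)%nat -> (i = 0 \/ m <= i)%nat ->
    u i x * cauchy_pow u q (l - i) x = 0).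
  { intros i x Hi [->|Hm]; [rewrite H0; ring|].
    rewrite cauchy_pow_vanish by (auto; lia); ring. }
  split.
  + apply trig_sum_f_R0 with (u := fun i x => u i x * cauchy_pow u q (l - i) x).
    intros i Hi.
    destruct (Nat.eq_dec i 0) as [E|E]; [apply trig_zero; intros; apply Hsmall; auto|].
    destruct (le_lt_dec m i) as [L|L]; [apply trig_zero; intros; apply Hsmall; auto|].
    replace (Nat.odd (S q)) with (xorb true (Nat.odd q))
      by (rewrite Nat.odd_succ, <- Nat.negb_odd; now destruct (Nat.odd q)).
    apply trig_mult; [now apply Ht | apply IH; lia].
  + intros H x; apply sum_eq_R0; intros i Hi.
    destruct (Nat.eq_dec i 0) as [E|E]; [apply Hsmall; auto|].
    destruct (le_lt_dec m i) as [L|L]; [apply Hsmall; auto|].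
    (* Indices add as [(j d + 1) + (j' d + q) = (j + j') d + (q + 1)]; if [l] is not of this form,
       one of the two factors is zero. *)
    destruct (classic (forall j, i <> (j * d + 1)%nat)) as [N|N].
    { rewrite (Hz i L N); ring. }
    rewrite (proj2 (IH (l - i)%nat ltac:(lia))); [ring|].
    apply not_all_ex_not in N; destruct N as [j N]; apply NNPP in N.
    intros j' E'; apply (H (j + j')%nat); lia.
Qed.

Lemma cosc_sum_f_R0 (u : nat -> R -> R) (k N : nat) :
  (forall l, cont (u l)) ->
  cosc (fun x => sum_f_R0 (fun l => u l x) N) k = sum_f_R0 (fun l => cosc (u l) k) N.
Proof.
intros Hu; rewrite <- sum_n_Reals, <- cosc_sum_n by auto.
apply cosc_ext; intros; now rewrite sum_n_Reals.
Qed.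

Lemma cosc_0 (f : R -> R) : cosc f 0 = mean f.
Proof. apply mean_ext; intros; simpl; rewrite Rmult_0_l, cos_0; ring. Qed.

Lemma Rpower_neg_lt_1 (alpha : R) (k : nat) :
  0 < alpha -> (2 <= k)%nat -> Rpower (INR k) (- alpha) < 1.
Proof.
intros Ha Hk; assert (H2 : INR 2 <= INR k) by now apply le_INR.
simpl in H2; rewrite <- (Rpower_O (INR k)) by lra; apply Rpower_lt; lra.
Qed.

(** The three conclusions are intertwined and so proved in one induction. Order [m] of the equation
    at frequency 1 yields [v (m - 1)], whence the shift in the last one. *)
Lemma recursion_structure (alpha : R) (p : nat) (u : nat -> R -> R) (v : nat -> R) :
  0 < alpha -> (3 <= p)%nat -> Nat.odd p = true ->
  (forall l, cont (u l)) -> (forall l, periodic (u l)) -> (forall l, even_fun (u l)) ->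
  (forall l, mean (u l) = 0) -> (forall x, u 0%nat x = 0) -> v 0%nat = 1 ->
  (forall l, cosc (u l) 1 = if (l =? 1)%nat then / 2 else 0) ->
  (forall k m, (1 <= k)%nat ->
     Rpower (INR k) (- alpha) * cosc (u m) k - PS_mult v (fun l => cosc (u l) k) m
       + cosc (cauchy_pow u p m) k = 0) ->
  forall m, trig true (u m) /\
    ((forall j, m <> (j * (p - 1) + 1)%nat) -> forall x, u m x = 0) /\
    (forall l, S l = m -> (forall j, l <> (j * (p - 1))%nat) -> v l = 0).
Proof.
intros Ha Hp Hodd Cu Pu Eu Mu u0 v0 Hnorm Heq m.
induction m as [m IH] using (well_founded_induction lt_wf).
destruct m as [|m].
{ split; [now apply trig_zero|]; split; [auto | lia]. }
assert (Hpow := cauchy_pow_structure (p - 1) (S m) u u0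
  (fun i Hi => proj1 (IH i Hi)) (fun i Hi => proj1 (proj2 (IH i Hi))) p (S m) ltac:(lia)).
destruct Hpow as [Htp Hzp]; rewrite Hodd in Htp.
(* For [m >= 1], the equation of order [m + 1] at [k = 1] reduces to [v m / 2 = 0]: only [u 1] has a
   first coefficient, and the power has no term of this order because
   [j (p - 1) + p = (j + 1) (p - 1) + 1]. *)
assert (Hv : forall l, S l = S m -> (forall j, l <> (j * (p - 1))%nat) -> v l = 0).
{ intros l El Hl; injection El as ->.
  destruct m as [|m]; [now specialize (Hl 0%nat)|].
  pose proof (Heq 1%nat (S (S m)) (le_n 1)) as E.
  rewrite (cosc_zero (cauchy_pow u p (S (S m)))) in E.
  2:{ apply Hzp; intros j Ej; apply (Hl (S j)); simpl; lia. }
  unfold PS_mult in E; rewrite 2!tech5, sum_eq_R0 in E.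
  2:{ intros i Hi; rewrite Hnorm, (proj2 (Nat.eqb_neq _ 1)) by lia; ring. }
  rewrite 3!Hnorm in E.
  replace (S (S m) - S m)%nat with 1%nat in E by lia.
  replace (S (S m) - S (S m))%nat with 0%nat in E by lia.
  cbn [Nat.eqb] in E; lra. }
assert (Hvall : forall l, (l <= m)%nat -> (forall j, l <> (j * (p - 1))%nat) -> v l = 0).
{ intros l Hl Hj; destruct (Nat.eq_dec l m) as [->|N]; [now apply Hv|].
  destruct (IH (S l) ltac:(lia)) as (_ & _ & H); now apply H. }
(* Known side of the equation at order [m + 1]: the term with [v 0 = 1] goes to the other side,
   giving the factor [k^(-alpha) - 1], and the remaining convolution is shifted by one. *)
set (h1 := fun x => sum_f_R0 (fun j => v (S j) * u (S m - S j)%nat x) m).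
set (h := fun x => h1 x + (-1) * cauchy_pow u p (S m) x).
assert (Hh1 : trig true h1).
{ apply trig_sum_f_R0 with (u := fun j x => v (S j) * u (S m - S j)%nat x).
  intros j Hj; apply trig_scal, IH; lia. }
assert (Hh : trig true h) by (apply trig_plus; auto using trig_scal).
assert (HA : forall k, (1 <= k)%nat ->
  (Rpower (INR k) (- alpha) - 1) * cosc (u (S m)) k = cosc h k).
{ intros k Hk; specialize (Heq k (S m) Hk).
  unfold PS_mult in Heq; rewrite decomp_sum in Heq by lia.
  rewrite v0, Nat.sub_0_r in Heq; cbn [Nat.pred] in Heq.
  unfold h, h1; rewrite cosc_plus, cosc_scal
    by (apply trig_cont with true; auto using trig_scal).
  rewrite (cosc_sum_f_R0 (fun j x => v (S j) * u (S m - S j)%nat x))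
    by auto using cont_scal.
  rewrite (sum_eq _ (fun j => v (S j) * cosc (u (S m - S j)%nat) k))
    by (intros; now apply cosc_scal).
  lra. }
(* [u (S m)] is determined by its mean, its first coefficient and the equation for [k >= 2], where
   the factor is nonzero. Below, [G] is first an odd cosine sum and then the zero function. *)
assert (Hcomplete : forall G, cont G -> periodic G -> even_fun G -> mean G = 0 ->
  cosc G 1 = (if (S m =? 1)%nat then / 2 else 0) ->
  (forall k, (2 <= k)%nat -> (Rpower (INR k) (- alpha) - 1) * cosc G k = cosc h k) ->
  forall x, u (S m) x = G x).
{ intros G CG PG EG MG G1 G2 x; apply Rminus_diag_uniq.
  apply (cosc_complete (fun x => u (S m) x - G x)).
  - now apply cont_minus.
  - intros y; now rewrite Pu, PG.
  - intros y; now rewrite Eu, EG.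
  - intros k; rewrite cosc_minus by auto.
    destruct k as [|[|k]].
    + rewrite 2!cosc_0, Mu, MG; ring.
    + rewrite Hnorm, G1; ring.
    + pose proof (Rpower_neg_lt_1 alpha (S (S k)) Ha ltac:(lia)).
      apply Rmult_eq_reg_l with (Rpower (INR (S (S k))) (- alpha) - 1); [|lra].
      rewrite Rmult_minus_distr_l, HA, G2 by lia; ring. }
split; [|split; auto].
(* The factor [k^(-alpha) - 1] vanishes at [k = 1], so its inverse is replaced by 0 there, and the
   multiple of [cos x] is put back from the parametrisation. *)
- destruct (trig_multiplier true
    (fun k => if (k <=? 1)%nat then 0 else / (Rpower (INR k) (- alpha) - 1)) h Hh)
    as (g & Hg & Hgk).
  set (G := fun x => (if (S m =? 1)%nat then 1 else 0) * cos (INR 1 * x) + g x).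
  assert (HG : trig true G) by (now apply (trig_add true (if (S m =? 1)%nat then 1 else 0) 1 g)).
  assert (HGk : forall k, cosc G k =
    (if (S m =? 1)%nat then 1 else 0) * cosc (fun x => cos (INR 1 * x)) k + cosc g k).
  { intros k; unfold G.
    rewrite cosc_plus, cosc_scal by eauto using cont_scal, cont_cos, trig_cont; ring. }
  destruct (trig_periodic_even _ _ HG) as [PG EG].
  apply (trig_ext true G); auto; apply Hcomplete; auto.
  + now apply trig_cont with true.
  + rewrite <- cosc_0, HGk, Hgk, cosc_cos_neq by lia; simpl; ring.
  + rewrite HGk, Hgk, cosc_cos_1; simpl; destruct (m =? 0)%nat; ring.
  + intros k Hk; rewrite HGk, Hgk, cosc_cos_neq by lia.
    rewrite (proj2 (Nat.leb_gt k 1)) by lia.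
    pose proof (Rpower_neg_lt_1 alpha k Ha Hk); field; lra.
- intros Hm.
  assert (Hh0 : forall x, h x = 0).
  { intros x; unfold h, h1; rewrite Hzp.
    2:{ intros j Ej; apply (Hm (S j)); simpl; lia. }
    rewrite sum_eq_R0; [ring|]; intros j Hj.
    (* The last term carries the still undetermined [v (S m)], but multiplied by [u 0 = 0]. *)
    destruct (Nat.eq_dec j m) as [->|N]; [rewrite Nat.sub_diag, u0; ring|].
    destruct (classic (forall i, S j <> (i * (p - 1))%nat)) as [Q|Q].
    { rewrite Hvall by (auto; lia); ring. }
    (* With [S j = i (p - 1)], the complementary index cannot be [i' (p - 1) + 1], or [S m] would
       have that form too. *)
    apply not_all_ex_not in Q; destruct Q as [i Q]; apply NNPP in Q.
    destruct (IH (S m - S j)%nat ltac:(lia)) as (_ & Hz & _).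
    rewrite Hz; [ring|]; intros i' Ei; apply (Hm (i + i')%nat); lia. }
  apply Hcomplete.
  + apply cont_const.
  + now intros x.
  + now intros x.
  + apply mean_const.
  + rewrite cosc_zero by auto.
    rewrite (proj2 (Nat.eqb_neq (S m) 1)) by exact (Hm 0%nat); reflexivity.
  + intros k _; rewrite 2!cosc_zero by auto; ring.
Qed.

(** * The bifurcation curve *)

(** The multiplier is real, so real parts of the Fourier identity relate cosine coefficients; the
    subtracted mean is a constant and contributes nothing for [k >= 1]. *)
Lemma steady_cosc (alpha c : R) (n phi : R -> R) (k : nat) :
  cont phi -> cont (fun x => n (phi x)) -> steady alpha n phi c -> (1 <= k)%nat ->
  Rpower (INR k) (- alpha) * cosc phi k - c * cosc phi k + cosc (fun x => n (phi x)) k = 0.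
Proof.
intros Cphi Cn (psi & (_ & Cpsi & _ & Hpsi) & Heq) Hk.
specialize (Hpsi (Z.of_nat k) ltac:(lia)); apply (f_equal fst) in Hpsi.
cbn [fourier fst Cmult RtoC snd] in Hpsi.
rewrite <- INR_IZR_INZ, Rmult_0_l, Rminus_0_r, Rabs_pos_eq in Hpsi by apply pos_INR.
fold (cosc psi k) (cosc phi k) in Hpsi; rewrite <- Hpsi.
set (mu := mean (fun y => n (phi y))) in Heq.
transitivity (cosc (fun x => (psi x - c * phi x) + (n (phi x) - mu)) k).
- rewrite cosc_plus, 2!cosc_minus, cosc_scal, cosc_const
    by auto using cont_minus, cont_scal, cont_const; ring.
- apply cosc_zero; intros x; specialize (Heq x); lra.
Qed.

Section Curve.

Context {alpha beta r : R} {p : nat} {phi : R -> R -> R} {c : R -> R}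
  {phic : nat -> R -> R} {varsigma : nat -> R}.
Hypothesis hbeta : 0 < beta.
Hypothesis hcurve : bifurcation_curve alpha beta (fun x => x ^ p) r phi c phic varsigma.

Lemma curve_phic_cont (l : nat) : cont (phic l).
Proof.
destruct (curve_phic_space _ _ _ _ _ _ _ _ hcurve l) as (_ & _ & H & _).
now apply holder_cont with beta.
Qed.

Lemma curve_phi_cont (s : R) : Rabs s < r -> cont (phi s).
Proof.
intros Hs; destruct (curve_space _ _ _ _ _ _ _ _ hcurve s Hs) as ((_ & _ & H & _) & _).
now apply holder_cont with beta.
Qed.

Lemma curve_phi_series (s x : R) :
  Rabs s < r -> is_series (fun l => phic l x * s ^ l) (phi s x).
Proof.
intros Hs.
exact (holder_series_pointwise _ _ _ x (curve_phi_expansion _ _ _ _ _ _ _ _ hcurve s Hs)).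
Qed.

(** Convergence at [s = r / 2] bounds the terms there by some [M], so
    [|phic l x| <= M (2 / r)^l]. *)
Lemma curve_expands : expands phi phic.
Proof.
pose proof (curve_radius _ _ _ _ _ _ _ _ hcurve) as Hr.
assert (Hr2 : Rabs (r / 2) < r) by (rewrite Rabs_pos_eq; lra).
destruct (holder_series_terms_bounded beta (fun l x => phic l x * (r / 2) ^ l) (phi (r / 2)))
  as (M & HM & HMb).
- intros l.
  destruct (curve_phic_space _ _ _ _ _ _ _ _ hcurve l) as (_ & _ & H & _).
  now apply holder_norm_scal.
- exact (curve_phi_expansion _ _ _ _ _ _ _ _ hcurve _ Hr2).
- assert (HK : 0 < / (r / 2)) by (apply Rinv_0_lt_compat; lra).
  exists M, (/ (r / 2)); repeat split; auto.
  + intros l x; specialize (HMb l x).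
    assert (0 < (r / 2) ^ l) by (apply pow_lt; lra).
    rewrite pow_inv; apply Rmult_le_reg_r with ((r / 2) ^ l); auto.
    rewrite Rmult_assoc, Rinv_l, Rmult_1_r by lra.
    now rewrite Rabs_mult, (Rabs_pos_eq ((r / 2) ^ l)) in HMb by lra.
  + intros s x Hs; apply is_pseries_R, curve_phi_series.
    apply Rmult_lt_compat_r with (r := r / 2) in Hs; [|lra].
    rewrite Rmult_assoc, Rinv_l in Hs by lra; lra.
Qed.

Lemma curve_phi_cosc (s : R) (k : nat) :
  Rabs s < r -> is_pseries (fun l => cosc (phic l) k) s (cosc (phi s) k).
Proof.
intros Hs; apply is_pseries_R.
apply is_series_ext with (fun l => cosc (fun x => phic l x * s ^ l) k).
- intros l; rewrite (cosc_ext _ (fun x => s ^ l * phic l x)) by (intros; ring).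
  rewrite cosc_scal by apply curve_phic_cont; apply Rmult_comm.
- apply is_series_cosc.
  + intros l; apply cont_mult; [apply curve_phic_cont | apply cont_const].
  + now apply curve_phi_cont.
  + intros eps Heps.
    exact (holder_series_sup _ _ _ (curve_phi_expansion _ _ _ _ _ _ _ _ hcurve s Hs) eps Heps).
Qed.

Lemma curve_phic_0 (x : R) : phic 0%nat x = 0.
Proof.
pose proof (curve_radius _ _ _ _ _ _ _ _ hcurve) as Hr.
rewrite <- (curve_phi0 _ _ _ _ _ _ _ _ hcurve x), <- (PSeries_0 (fun l => phic l x)).
apply is_pseries_unique, is_pseries_R, curve_phi_series; now rewrite Rabs_R0.
Qed.

Lemma curve_varsigma_0 : varsigma 0%nat = 1.
Proof.
pose proof (curve_radius _ _ _ _ _ _ _ _ hcurve) as Hr.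
rewrite <- (curve_c0 _ _ _ _ _ _ _ _ hcurve), <- (PSeries_0 varsigma).
apply is_pseries_unique, is_pseries_R, (curve_c_expansion _ _ _ _ _ _ _ _ hcurve).
now rewrite Rabs_R0.
Qed.

(** The parametrisation reads [cosc (phi s) 1 = s / 2]; coefficients are compared with those of the
    monomial. *)
Lemma curve_phic_first (l : nat) : cosc (phic l) 1 = if (l =? 1)%nat then / 2 else 0.
Proof.
pose proof (curve_radius _ _ _ _ _ _ _ _ hcurve) as Hr; pose proof PI_RGT_0.
apply Rminus_diag_uniq; revert l.
apply (pseries_zero (fun l => cosc (phic l) 1 - if (l =? 1)%nat then / 2 else 0) r Hr).
intros s Hs.
assert (Es : cosc (phi s) 1 = / 2 * s ^ 1).
{ rewrite <- (curve_param _ _ _ _ _ _ _ _ hcurve s Hs) at 2.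
  unfold cosc, mean; simpl INR.
  rewrite (RInt_ext (fun x => phi s x * cos (1 * x)) (fun x => phi s x * cos x))
    by (intros; now rewrite Rmult_1_l).
  field; lra. }
assert (E0 : minus (cosc (phi s) 1) (/ 2 * s ^ 1) = 0) by (rewrite Es; apply Rplus_opp_r).
assert (Hp : is_pseries (PS_minus (V := R_NormedModule) (fun l => cosc (phic l) 1)
  (fun l => if (l =? 1)%nat then / 2 else 0)) s (minus (cosc (phi s) 1) (/ 2 * s ^ 1))).
{ apply (is_pseries_minus (V := R_NormedModule)).
  - now apply curve_phi_cosc.
  - apply is_pseries_monomial. }
rewrite E0 in Hp; exact Hp.
Qed.

(** The left side is the [m]-th coefficient of a power series whose sum is the [k]-th cosine
    coefficient of the steady equation, hence 0 for small [s]. *)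
Lemma curve_recursion (k m : nat) : (1 <= k)%nat ->
  Rpower (INR k) (- alpha) * cosc (phic m) k - PS_mult varsigma (fun l => cosc (phic l) k) m
    + cosc (cauchy_pow phic p m) k = 0.
Proof.
intros Hk; pose proof (curve_radius _ _ _ _ _ _ _ _ hcurve) as Hr.
destruct (expands_cosc (fun s x => phi s x ^ p) (cauchy_pow phic p) r k Hr) as (d & Hd & Hdr & HB).
{ intros l; apply cauchy_pow_cont, curve_phic_cont. }
{ intros s Hs; now apply cont_pow, curve_phi_cont. }
{ apply expands_pow, curve_expands. }
revert m.
apply (pseries_zero (fun m => Rpower (INR k) (- alpha) * cosc (phic m) k
  - PS_mult varsigma (fun l => cosc (phic l) k) m + cosc (cauchy_pow phic p m) k) d Hd).
intros s Hs; assert (Hsr : Rabs s < r) by lra.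
rewrite <- (steady_cosc alpha (c s) (fun x => x ^ p) (phi s) k);
  auto using curve_phi_cont, cont_pow.
2:{ exact (curve_steady _ _ _ _ _ _ _ _ hcurve s Hsr). }
pose proof (curve_phi_cosc s k Hsr) as HA.
assert (HC : is_pseries varsigma s (c s))
  by now apply is_pseries_R, (curve_c_expansion _ _ _ _ _ _ _ _ hcurve).
apply (is_pseries_plus (V := R_NormedModule)
  (fun m => Rpower (INR k) (- alpha) * cosc (phic m) k
     - PS_mult varsigma (fun l => cosc (phic l) k) m)); [|now apply HB].
apply (is_pseries_minus (V := R_NormedModule)
  (fun m => Rpower (INR k) (- alpha) * cosc (phic m) k)).
- apply (is_pseries_scal (V := R_NormedModule) _ (fun m => cosc (phic m) k)); auto.
  apply Rmult_comm.
- apply is_pseries_mult; auto; apply CV_radius_of_disk with r; auto; intros t Ht.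
  + exists (c t); now apply is_pseries_R, (curve_c_expansion _ _ _ _ _ _ _ _ hcurve).
  + exists (cosc (phi t) k); now apply curve_phi_cosc.
Qed.

End Curve.

(** * Series supported on an arithmetic progression *)

Lemma sum_n_lacunary (u : nat -> R) (q e J : nat) :
  (1 <= q)%nat -> (e < q)%nat -> (forall l, (forall j, l <> (j * q + e)%nat) -> u l = 0) ->
  sum_n (fun j => u (j * q + e)%nat) J = sum_n u (J * q + e).
Proof.
intros Hq Heq Hu.
assert (Hgap : forall n d, (forall i, (n < i <= n + d)%nat -> u i = 0) ->
  sum_n u (n + d) = sum_n u n).
{ intros n d; induction d as [|d IHd]; intros H; [now rewrite Nat.add_0_r|].
  rewrite Nat.add_succ_r, sum_Sn, H, IHd by (intros; try apply H; lia).
  unfold plus; simpl; ring. }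
assert (Hres : forall j i, (j * q + e < i < S j * q + e)%nat -> u i = 0).
{ intros j i Hi; apply Hu; intros j' ->; destruct (le_lt_dec j' j); nia. }
induction J as [|J IH].
(* As [e < q], all terms of index below [e] are zero. *)
- rewrite sum_O; destruct e as [|e]; [simpl; now rewrite sum_O|].
  assert (G := Hgap 0%nat e); rewrite Nat.add_0_l in G.
  rewrite Nat.mul_0_l, Nat.add_0_l, sum_Sn, G, sum_O, (Hu 0%nat).
  + unfold plus; simpl; ring.
  + intros j; nia.
  + intros i Hi; apply Hu; intros [|j]; nia.
- rewrite sum_Sn, IH.
  (* The next block consists of [q - 1] zeros followed by one term of the progression. *)
  replace (S J * q + e)%nat with (S (J * q + e + (q - 1))) by (simpl; lia).
  rewrite sum_Sn, (Hgap (J * q + e)%nat); [reflexivity|].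
  intros i Hi; apply (Hres J); simpl; lia.
Qed.

Lemma eventually_lacunary (q e : nat) (P : nat -> Prop) :
  (1 <= q)%nat -> eventually P -> eventually (fun J => P (J * q + e)%nat).
Proof. intros Hq [N HN]; exists N; intros J HJ; apply HN; nia. Qed.

Theorem proposition4p5
  (alpha beta : R) (p : nat)
  (halpha : 0 < alpha < 1)
  (hbeta : Rmax alpha (1 / 2) < beta < 1)
  (hp3 : (3 <= p)%nat) (hpodd : Nat.Odd p)
  (r : R) (phi : R -> R -> R) (c : R -> R)
  (phic : nat -> R -> R) (varsigma : nat -> R)
  (hcurve : bifurcation_curve alpha beta (fun x => x ^ p) r phi c phic varsigma) :
  (forall l : nat, (forall j : nat, l <> (j * (p - 1) + 1)%nat) ->
     forall x, phic l x = 0) /\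
  (forall l : nat, (forall j : nat, l <> (j * (p - 1))%nat) -> varsigma l = 0) /\
  (forall s, Rabs s < r ->
     is_holder_series beta
       (fun j x => phic (j * (p - 1) + 1)%nat x * s ^ (j * (p - 1) + 1)) (phi s) /\
     is_series (fun j => varsigma (j * (p - 1))%nat * s ^ (j * (p - 1))) (c s)) /\
  (forall j : nat, Wspan (phic (j * (p - 1) + 1)%nat)) /\
  (forall j : nat,
     antiperiodic_PI (phic (j * (p - 1) + 1)%nat) /\
     antisymmetric_about (- (PI / 2)) (phic (j * (p - 1) + 1)%nat)) /\
  (forall s, Rabs s < r ->
     antiperiodic_PI (phi s) /\ antisymmetric_about (- (PI / 2)) (phi s)).
Proof.
assert (hb : 0 < beta) by (pose proof (Rmax_l alpha (1 / 2)); lra).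
assert (Hrec := recursion_structure alpha p phic varsigma (proj1 halpha) hp3
  (proj2 (Nat.odd_spec p) hpodd) (curve_phic_cont hb hcurve)
  (fun l => proj1 (curve_phic_space _ _ _ _ _ _ _ _ hcurve l))
  (fun l => proj1 (proj2 (curve_phic_space _ _ _ _ _ _ _ _ hcurve l)))
  (fun l => proj2 (proj2 (proj2 (curve_phic_space _ _ _ _ _ _ _ _ hcurve l))))
  (curve_phic_0 hcurve) (curve_varsigma_0 hcurve)
  (curve_phic_first hb hcurve) (curve_recursion hb hcurve)).
assert (Hphi : forall l, (forall j, l <> (j * (p - 1) + 1)%nat) -> forall x, phic l x = 0)
  by (intros l; apply Hrec).
assert (Hvs : forall l, (forall j, l <> (j * (p - 1))%nat) -> varsigma l = 0)
  by (intros l Hl; destruct (Hrec (S l)) as (_ & _ & H); now apply H).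
(* Evenness turns [f (a - x)] into [f (x - a)], and for [a = - (PI / 2)] the points [x - a] and
   [a + x] differ by [PI]. *)
assert (Hanti : forall f, even_fun f -> antiperiodic_PI f -> antisymmetric_about (- (PI / 2)) f).
{ intros f He Hf x; rewrite <- (He (- (PI / 2) - x)).
  replace (- (- (PI / 2) - x)) with (- (PI / 2) + x + PI) by field.
  rewrite Hf; ring. }
split; [exact Hphi|]; split; [exact Hvs|].
split; [intros s Hs; split|split; [|split]].
(* Partial sums of the compressed series form a subsequence of the full ones, so convergence in the
   Hölder norm is inherited. *)
- intros eps Heps.
  apply filter_imp with (2 := eventually_lacunary (p - 1) 1 _ ltac:(lia)
    (curve_phi_expansion _ _ _ _ _ _ _ _ hcurve s Hs eps Heps)).
  intros J HJ.
  replace (fun x => phi s x - sum_n (fun j => phic (j * (p - 1) + 1)%nat x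
      * s ^ (j * (p - 1) + 1)) J)
    with (fun x => phi s x - sum_n (fun l => phic l x * s ^ l) (J * (p - 1) + 1)); auto.
  apply functional_extensionality; intros x; f_equal; symmetry.
  apply (sum_n_lacunary (fun l => phic l x * s ^ l)); try lia.
  intros l Hl; rewrite Hphi by auto; ring.
(* The same argument with offset 0, where [P] is a neighbourhood of [c s]. *)
- intros P HP.
  apply filter_imp with (2 := eventually_lacunary (p - 1) 0 _ ltac:(lia)
    (curve_c_expansion _ _ _ _ _ _ _ _ hcurve s Hs P HP)).
  intros J HJ.
  rewrite <- (sum_n_lacunary (fun l => varsigma l * s ^ l)) in HJ; try lia.
  + rewrite (sum_n_ext _ (fun j => varsigma (j * (p - 1) + 0)%nat * s ^ (j * (p - 1) + 0)));
      [exact HJ | intros; now rewrite Nat.add_0_r].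
  + intros l Hl; rewrite Hvs; [ring|].
    intros j; specialize (Hl j); now rewrite Nat.add_0_r in Hl.
- intros j; apply trig_odd_Wspan, Hrec.
- intros j; split; [apply trig_odd_antiperiodic, Hrec|].
  apply Hanti; [apply (curve_phic_space _ _ _ _ _ _ _ _ hcurve)|].
  apply trig_odd_antiperiodic, Hrec.
- intros s Hs.
  assert (Hap : antiperiodic_PI (phi s)).
  { intros x.
    rewrite <- (is_series_unique _ _ (curve_phi_series hcurve s (x + PI) Hs)).
    rewrite <- (is_series_unique _ _ (curve_phi_series hcurve s x Hs)), <- Series_opp.
    apply Series_ext; intros l.
    rewrite (trig_odd_antiperiodic _ (proj1 (Hrec l))); ring. }
  split; auto; apply Hanti; auto.
  apply (curve_space _ _ _ _ _ _ _ _ hcurve s Hs).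
Qed.
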